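(* (i) For every $n\geq 4$ and every $G\in\mathcal{GAQ}_n$, $G$ is fractional strongly maximally matched, i.e. $fsmp(G)=2n-1$. (ii) For every $n\geq 4$ and every $G\in\mathcal{RGAQ}_n$, $G$ is fractional strongly super matched.
   Context: The $n$-dimensional augmented cube $AQ_n$ ($n\geq 1$) has vertex set all binary strings $u_1u_2\cdots u_n$. $AQ_1\cong K_2$ on vertices $0,1$. For $n\geq 2$, $AQ_n$ consists of a copy $AQ^0_{n-1}$ of $AQ_{n-1}$ with $0$ prefixed to every label and a copy $AQ^1_{n-1}$ with $1$ prefixed, plus the following edges: $0u_1\cdots u_{n-1}$ is adjacent to $1v_1\cdots v_{n-1}$ iff either $u_i=v_i$ for all $i$ (cross edge) or $u_i\neq v_i$ for all $i$ (complement edge). Generalized augmented cubes: $\mathcal{GAQ}_4=\{AQ_4\}$; for $n\geq 5$, $\mathcal{GAQ}_n$ consists of all graphs $(V_1\cup V_2, E_1\cup E_2\cup M_1\cup M_2)$ where $(V_1,E_1),(V_2,E_2)$ are (vertex-disjoint copies of, possibly identical) graphs in $\mathcal{GAQ}_{n-1}$ and $M_1,M_2$ are edge-disjoint perfect matchings between $V_1$ and $V_2$; such graphs are $(2n-1)$-regular on $2^n$ vertices. Restricted generalized a-cubes: $\mathcal{RGAQ}_4=\{AQ_4\}$; for $n\geq 5$, $\mathcal{RGAQ}_n$ consists of all graphs obtained as in the definition of $\mathcal{GAQ}_n$ from $G_1,G_2\in\mathcal{GAQ}_{n-1}$ with the additional requirement that the edge set $M_1\cup M_2$ contains neither a 4-cycle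 nor a 6-cycle. For $F\subseteq V(G)\cup E(G)$, $G-F$ denotes $G$ with the vertices and edges of $F$ deleted. A fractional perfect matching of $G$ is $f:E(G)\to[0,1]$ with $\sum_{e\ni v}f(e)=1$ for every vertex $v$. A fractional strong matching preclusion (FSMP) set is $F\subseteq V(G)\cup E(G)$ with $G-F$ having no fractional perfect matching; $fsmp(G)$ is the minimum size of an FSMP set, and an FSMP set of that size is optimal. $G$ is fractional strongly maximally matched if $fsmp(G)=\delta(G)$, and fractional strongly super matched if in addition $G-F$ has an isolated vertex for every optimal FSMP set $F$. *)

(* Defs.v *)
From Stdlib Require Import Rdefinitions.
From HB Require Import structures.
From mathcomp Require Import all_boot.

Set Implicit Arguments.
Unset Strict Implicit.
Unset Printing Implicit Defensive.

Definition all_differ (u v : seq bool) : bool := all2 (fun a b => a != b) u v.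

(* adjacency of AQ_n on bit strings (first letter = prefix bit):
   aq [a] [b] = (a != b)  (AQ_1 = K_2);
   0u ~ 0v iff u ~ v in AQ_{n-1}, same for 1;
   0u ~ 1v iff u = v (cross edge) or u,v differ everywhere (complement edge). *)
Fixpoint aq (u v : seq bool) : bool :=
  match u, v with
  | a :: u', b :: v' =>
      if a == b then aq u' v' else (u' == v') || all_differ u' v'
  | _, _ => false
  end.

Definition AQrel (n : nat) : rel (n.-tuple bool) := fun x y => aq x y.

Definition isoAQ (n : nat) (T : finType) (e : rel T) : Prop :=
  exists f : T -> n.-tuple bool, bijective f /\ forall x y, e x y = AQrel (f x) (f y).

Definition subrel (T : finType) (A : {set T}) (e : rel T) : rel {x : T | x \in A} :=
  fun x y => e (val x) (val y).
Arguments subrel {T} A e.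

(* A graph is a finite type T with an adjacency relation e.
   GAQ step: V = A (disjoint union) ~:A, G[A], G[~:A] in GAQ_{n-1},
   the edges between A and ~:A are exactly M1 u M2 where M1, M2 are the
   perfect matchings given by bijections g1, g2 : A -> ~:A with g1 x <> g2 x
   (edge-disjointness). *)
Inductive isGAQ : nat -> forall T : finType, rel T -> Prop :=
| GAQ_base (T : finType) (e : rel T) : isoAQ 4 e -> isGAQ 4 e
| GAQ_step (n : nat) (T : finType) (e : rel T) (A : {set T})
    (g1 g2 : {x : T | x \in A} -> {x : T | x \in ~: A}) :
    isGAQ n (subrel A e) ->
    isGAQ n (subrel (~: A) e) ->
    bijective g1 -> bijective g2 ->
    (forall x, g1 x != g2 x) ->
    symmetric e ->
    (forall (x : {x : T | x \in A}) (y : {x : T | x \in ~: A}),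
        e (val x) (val y) = (g1 x == y) || (g2 x == y)) ->
    isGAQ n.+1 e.

Definition has_cycle (T : finType) (k : nat) (h : rel T) : Prop :=
  exists s : seq T, size s = k /\ uniq s /\ cycle h s.

Definition isRGAQ (n : nat) (T : finType) (e : rel T) : Prop :=
  (n = 4 /\ isoAQ 4 e) \/
  (exists m : nat, n = m.+1 /\ 4 <= m /\
   exists (A : {set T}) (g1 g2 : {x : T | x \in A} -> {x : T | x \in ~: A}),
    [/\ isGAQ m (subrel A e), isGAQ m (subrel (~: A) e),
        bijective g1, bijective g2 & (forall x, g1 x != g2 x)] /\
    symmetric e /\
    (forall (x : {x : T | x \in A}) (y : {x : T | x \in ~: A}),
        e (val x) (val y) = (g1 x == y) || (g2 x == y)) /\
    let M := fun x y => e x y && ((x \in A) != (y \in A)) in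
    ~ has_cycle 4 M /\ ~ has_cycle 6 M).

(* A set F of vertices and edges is a pair (FV, FE); edges are 2-sets {x,y}. *)
Definition valid_F (T : finType) (e : rel T) (FE : {set {set T}}) : Prop :=
  forall S, S \in FE -> exists x y, e x y /\ S = [set x; y].

Definition del_rel (T : finType) (e : rel T) (FV : {set T}) (FE : {set {set T}}) : rel T :=
  fun x y => [&& e x y, x \notin FV, y \notin FV & [set x; y] \notin FE].

Definition has_fpm (T : finType) (W : {set T}) (h : rel T) : Prop :=
  exists f : T -> T -> R,
    (forall x y, f x y = f y x) /\
    (forall x y, h x y -> Rle R0 (f x y) /\ Rle (f x y) R1) /\
    (forall x, x \in W -> \big[Rplus/R0]_(y | h x y) f x y = R1).

Definition FSMP_set (T : finType) (e : rel T) (FV : {set T}) (FE : {set {set T}}) : Prop :=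
  valid_F e FE /\ ~ has_fpm (~: FV) (del_rel e FV FE).

Definition fsmp_is (T : finType) (e : rel T) (k : nat) : Prop :=
  (exists FV FE, FSMP_set e FV FE /\ #|FV| + #|FE| = k) /\
  (forall FV FE, FSMP_set e FV FE -> k <= #|FV| + #|FE|).

Definition min_degree (T : finType) (e : rel T) : nat :=
  \big[minn/#|T|]_(x : T) #|[set y | e x y]|.

Definition frac_strongly_max_matched (T : finType) (e : rel T) : Prop :=
  fsmp_is e (min_degree e).

Definition frac_strongly_super_matched (T : finType) (e : rel T) : Prop :=
  frac_strongly_max_matched e /\
  forall k, fsmp_is e k ->
  forall FV FE, FSMP_set e FV FE -> #|FV| + #|FE| = k ->
    exists x, x \notin FV /\ forall y, ~~ del_rel e FV FE x y.

(* Main.v *)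
(* By Hall's theorem on the bipartite double cover, [G - F] has no fractional
   perfect matching iff some set [I] of surviving vertices spans no surviving
   edge and has fewer than [#|I|] surviving neighbours. The cheapest [F] with
   this effect deletes the [e(I)] edges inside [I] and all but [#|I| - 1] of the
   boundary vertices of [I], hence costs [e(I) + max(0, b(I) - #|I| + 1)]. It
   remains to bound this cost below by the degree [d] for every nonempty [I]
   (and by [d + 1] when [#|I| >= 2], for super matchedness).

   Since the graph is [d]-regular, [d (#|I| - b(I)) <= 2 e(I)], so the bound [d]
   on the cost implies [e(I) + b(I) - #|I| + 1 >= d - 1] in all cases. This
   quantity is superadditive up to 1 over the two halves of [G], which settles
   the sets meeting both halves; a set inside one half gains at least [#|I|]
   boundary vertices through the matchings, and [3] when [#|I| = 2] and the
   matchings form no 4-cycle. For AQ_4 the bound is checked by exhaustion. *)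

Require Import Defs.
From Stdlib Require Import Rdefinitions Reals Lra.
From HB Require Import structures.
From mathcomp Require Import all_boot zify.

Set Implicit Arguments.
Unset Strict Implicit.
Unset Printing Implicit Defensive.

Delimit Scope R_scope with coqR.

(** * Hall's theorem and fractional perfect matchings *)

Lemma RplusA : associative Rplus.
Proof. by move=> x y z; rewrite Rplus_assoc. Qed.

HB.instance Definition _ :=
  Monoid.isComLaw.Build R R0 Rplus RplusA Rplus_comm Rplus_0_l.

Section Hall.
Variable T : finType.
Implicit Types (r : rel T) (X Y Z B : {set T}).

Definition nbhd r B Y := [set u in B | [exists y in Y, r y u]].

Lemma nbhdP r B Y u :
  reflect (u \in B /\ exists2 y, y \in Y & r y u) (u \in nbhd r B Y).
Proof.
rewrite inE; apply: (iffP andP) => -[uB] h; split=> //.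
  by case/existsP: h => y /andP[]; exists y.
by case: h => y yY ryu; apply/existsP; exists y; rewrite yY.
Qed.

Lemma nbhdU r B Y Z : nbhd r B (Y :|: Z) = nbhd r B Y :|: nbhd r B Z.
Proof.
apply/setP=> u; apply/nbhdP/setUP.
  by case=> uB [y /setUP[] yY ryu]; [left|right]; apply/nbhdP; split=> //; exists y.
by case=> /nbhdP[uB [y yY ryu]]; split=> //; exists y; rewrite // inE yY ?orbT.
Qed.

Lemma nbhdD r B C Y : nbhd r (B :\: C) Y = nbhd r B Y :\: C.
Proof. by apply/setP=> u; rewrite !inE -andbA. Qed.

(** Both cases of Hall's theorem end here: a matching of [Y] into [C] and one of the remaining
    vertices avoiding [C] cannot collide. *)
Lemma hall_glue r X Y B C (f g : T -> T) :
    Y \subset X ->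
    {in Y &, injective f} -> (forall x, x \in Y -> f x \in nbhd r C [set x]) ->
    {in X :\: Y &, injective g} ->
    (forall x, x \in X :\: Y -> g x \in nbhd r (B :\: C) [set x]) ->
    C \subset B ->
  exists2 h : T -> T, {in X &, injective h} &
    forall x, x \in X -> h x \in nbhd r B [set x].
Proof.
move=> sYX injf fP injg gP sCB; exists (fun x => if x \in Y then f x else g x).
  have fg x y : x \in Y -> y \in X :\: Y -> f x <> g y.
    move=> /fP; rewrite inE => /andP[fC _] /gP; rewrite !inE => /andP[/andP[gC _] _] E.
    by rewrite -E fC in gC.
  move=> x y xX yX; case: ifP => xY; case: ifP => yY.
  - exact: injf.
  - by move/fg; case=> //; rewrite inE yY.
  - by move/esym/fg; case=> //; rewrite inE xY.
  by apply: injg; rewrite inE ?xY ?yY.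
move=> x xX; case: ifP => xY.
  by have:= fP _ xY; rewrite !inE => /andP[/(subsetP sCB)-> ->].
have:= gP x; rewrite !inE xY xX => /(_ isT) /andP[/andP[_ ->] ->] //.
Qed.

(** Induction on the size of [X]. If some nonempty proper [Y] is tight, match [Y] into its
    neighbourhood and the rest outside it. Otherwise every such set has a spare neighbour, and an
    arbitrary first edge can be fixed. *)
Theorem hall r X B :
    (forall Y, Y \subset X -> #|Y| <= #|nbhd r B Y|) ->
  exists2 f : T -> T, {in X &, injective f} &
    forall x, x \in X -> f x \in nbhd r B [set x].
Proof.
have [n] := ubnP #|X|; elim: n => // n IHn in X B *; rewrite ltnS => leXn hX.
have [->|[x xX]] := set_0Vmem X.
  by exists id => x; rewrite inE.
have [/existsP[Y /and3P[Y0 pY tY]]|] :=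
  boolP [exists Y : {set T}, [&& Y != set0, Y \proper X & #|nbhd r B Y| <= #|Y|]].
  have sYX := proper_sub pY.
  have ltYX := proper_card pY.
  have Ypos : 0 < #|Y| by rewrite card_gt0.
  have sN : nbhd r B Y \subset B by apply/subsetP=> u; rewrite inE => /andP[].
  have [||f injf fP] := IHn Y (nbhd r B Y); first by lia.
    move=> Z sZY; suff -> : nbhd r (nbhd r B Y) Z = nbhd r B Z.
      by apply/hX/(subset_trans sZY).
    apply/setP=> u; apply/nbhdP/nbhdP => -[uB [z zZ rzu]]; split; try by exists z.
      exact: (subsetP sN).
    by apply/nbhdP; split=> //; exists z => //; apply: (subsetP sZY).
  have cD : #|X :\: Y| = #|X| - #|Y| by rewrite cardsD (setIidPr sYX).
  (* Hall's condition survives here: apply it to [Y :|: Z] and subtract the tight set [Y]. *)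
  have [||g injg gP] := IHn (X :\: Y) (B :\: nbhd r B Y); first by lia.
    move=> Z; rewrite subsetD => /andP[sZX dZY].
    have := hX (Y :|: Z); rewrite subUset sYX sZX nbhdU => /(_ isT).
    rewrite cardsU disjoint_setI0 1?disjoint_sym // cards0 subn0.
    rewrite nbhdD cardsD setIC cardsU; lia.
  exact: (hall_glue sYX injf fP injg gP).
rewrite negb_exists => /forallP hY.
have /hX : [set x] \subset X by rewrite sub1set.
rewrite cards1 => /card_gt0P[u uN]; have /nbhdP[uB _] := uN.
have [||g injg gP] := IHn (X :\: [set x]) (B :\: [set u]).
- by move: leXn; rewrite (cardsD1 x X) xX; lia.
(* Removing [u] costs [Z] at most one neighbour, which the strict inequality for non-tight sets
   absorbs. *)
- move=> Z; rewrite subsetD => /andP[sZX dZx].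
  rewrite nbhdD cardsD; set c := #|_ :&: [set u]|.
  have: c <= 1 by rewrite -(cards1 u) subset_leq_card // subsetIr.
  have := hY Z; have [->|Z0] := eqVneq Z set0; first by rewrite cards0; lia.
  suff -> : Z \proper X by rewrite /= -ltnNge; lia.
  rewrite properEneq sZX andbT; apply: contraTneq dZx => ->.
  by rewrite disjoint_sym disjoints1 xX.
apply: (@hall_glue r X [set x] B [set u] (fun=> u) g) => //.
- by rewrite sub1set.
- by move=> a b /set1P-> /set1P->.
- by move=> a /set1P->; move: uN; rewrite !inE eqxx => /andP[].
by rewrite sub1set.
Qed.

(* A matching of the bipartite double cover is an injection [s] of [W] into
   itself along edges; putting weight 1/2 on each arc [x -> s x] gives a
   fractional perfect matching. *)
Lemma has_fpm_inj (W : {set T}) (h : rel T) (s : T -> T) :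
    symmetric h -> {in W &, injective s} ->
    (forall x, x \in W -> (s x \in W) && h x (s x)) ->
  has_fpm W h.
Proof.
move=> symh injs sP.
pose a x y : R := if (x \in W) && (s x == y) then (/ 2)%coqR else R0.
have a01 x y : (0 <= a x y <= / 2)%coqR by rewrite /a; case: ifP => _; lra.
exists (fun x y => (a x y + a y x)%coqR); split=> [x y|]; first exact: Rplus_comm.
split=> [x y _|x xW]; first by move: (a01 x y) (a01 y x); lra.
rewrite big_split /=.
(* An injection of the finite set [W] into itself is onto, so each [x] has exactly one outgoing and
   one incoming arc, of weight 1/2 each. *)
have sWW : s @: W = W.
  apply/eqP; rewrite eqEcard card_in_imset // leqnn andbT.
  by apply/subsetP=> _ /imsetP[y /sP/andP[? _] ->].
have /imsetP[z zW xE] : x \in s @: W by rewrite sWW.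
have /andP[_ hxs] := sP _ xW; have /andP[_ hzs] := sP _ zW.
rewrite (bigD1 (s x)) //= big1 => [|y /andP[_ ny]]; last first.
  by rewrite /a eq_sym (negPf ny) andbF.
rewrite (bigD1 z) /=; last by rewrite xE symh.
rewrite big1 => [|y /andP[_ ny]]; last first.
  rewrite /a; case: ifP => // /andP[yW /eqP sy].
  by case/eqP: ny; apply: injs; rewrite // sy.
by rewrite /a xW eqxx zW xE eqxx /=; lra.
Qed.

(** A Hall violator [X] becomes independent when the vertices of its own neighbourhood are dropped.
    The neighbours of what remains avoid [X], so both sides lose the same overlap and the deficiency
    persists. *)
Lemma no_fpm_independent (W : {set T}) (h : rel T) :
    symmetric h -> (forall x y, h x y -> y \in W) -> ~ has_fpm W h ->
  exists I : {set T}, [/\ I \subset W, {in I &, forall x y, ~~ h x y} &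
    #|nbhd h W I| < #|I|].
Proof.
move=> symh hW nofpm.
have [/existsP[X /andP[sXW ltX]]|] :=
  boolP [exists X : {set T}, (X \subset W) && (#|nbhd h W X| < #|X|)]; last first.
  rewrite negb_exists => /forallP hX; case: nofpm.
  have [Y sY|s injs sP] := @hall h W W.
    by have := hX Y; rewrite sY /= -leqNgt.
  apply: (has_fpm_inj symh injs) => x /sP/nbhdP[-> [y /set1P-> ->]] //.
exists (X :\: nbhd h W X); split.
- exact: subset_trans (subsetDl _ _) sXW.
- move=> x y /setDP[xX _] /setDP[yX]; apply: contra => hxy.
  by apply/nbhdP; split; [apply: hW hxy | exists x].
have sN : nbhd h W (X :\: nbhd h W X) \subset nbhd h W X :\: X.
  apply/subsetP=> u /nbhdP[uW [y /setDP[yX yN] hyu]].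
  apply/setDP; split; first by apply/nbhdP; split=> //; exists y.
  apply: contra yN => uX; apply/nbhdP; split; last by exists u; rewrite // symh.
  exact: (subsetP sXW).
apply: (leq_ltn_trans (subset_leq_card sN)).
have := cardsID X (nbhd h W X); have := cardsID (nbhd h W X) X.
by rewrite setIC; lia.
Qed.

End Hall.

(** * The deletion cost of a vertex set in a regular graph *)

Section Robust.
Variables (T : finType) (e : rel T).
Implicit Types (A I : {set T}).

Definition nbrs A x := [set y in A | e x y].

(* Counts every edge inside [I] twice. *)
Definition arcs I := \sum_(x in I) #|nbrs I x|.

Definition bdry A I := [set y in A | (y \notin I) && [exists x in I, e x y]].

Definition regular_on d A := forall x, x \in A -> #|nbrs A x| = d.

(* Making [I] a Hall violator costs the deletion of all edges inside [I] and of
   all but [#|I| - 1] boundary vertices; [robust d k A] says that this cost is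
   at least [d] in the subgraph induced by [A], for every [I] of size >= [k]
   (all quantities are doubled). *)
Definition robust d k A := forall I, I \subset A -> k <= #|I| ->
  d.*2 <= arcs I \/ d.*2 + #|I|.*2 <= arcs I + #|bdry A I|.+1.*2.

Lemma bdryP A I y :
  reflect [/\ y \in A, y \notin I & exists2 x, x \in I & e x y] (y \in bdry A I).
Proof.
rewrite inE; apply: (iffP and3P) => -[yA yI h]; split=> //.
  by case/existsP: h => x /andP[]; exists x.
by case: h => x xI exy; apply/existsP; exists x; rewrite xI.
Qed.

Lemma sum_nbrs A I :
  symmetric e -> \sum_(x in I) #|nbrs A x| = \sum_(y in A) #|nbrs I y|.
Proof.
move=> symE.
have cE B x : #|nbrs B x| = \sum_(y in B) (e x y : nat).
  rewrite -sum1_card big_mkcond [RHS]big_mkcond; apply: eq_bigr => y _.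
  by rewrite inE; case: (y \in B); case: (e x y).
rewrite (eq_bigr _ (fun x _ => cE A x)) exchange_big /=.
by apply: eq_bigr => y _; rewrite cE; apply: eq_bigr => x _; rewrite symE.
Qed.

(** The [d * #|I|] arcs leaving [I] end in [I] or in its boundary, and each boundary vertex receives
    at most [d] of them. *)
Lemma arcs_lower d A I : symmetric e -> regular_on d A -> I \subset A ->
  d * #|I| <= arcs I + d * #|bdry A I|.
Proof.
move=> symE regA sIA.
have -> : d * #|I| = \sum_(x in I) #|nbrs A x|.
  rewrite mulnC -sum_nat_const; apply: eq_bigr => x xI.
  by rewrite regA // (subsetP sIA).
rewrite sum_nbrs // (big_setID I) /= (setIidPr sIA) leq_add2l.
rewrite mulnC -sum_nat_const (big_setID (bdry A I)) /=.
rewrite [X in _ + X]big1 => [|y /setDP[/setDP[yA yI]]].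
  rewrite addn0 (setIidPr _).
    apply: leq_sum => y /bdryP[yA _ _]; rewrite -(regA y yA) subset_leq_card //.
    by apply/subsetP=> z; rewrite !inE => /andP[/(subsetP sIA)-> ->].
  by apply/subsetP=> y /bdryP[yA yI _]; rewrite !inE yI.
move=> nb; apply/eqP; rewrite cards_eq0 -subset0; apply/subsetP=> z.
rewrite !inE => /andP[zI eyz]; case/bdryP: nb; split=> //; exists z => //.
by rewrite symE.
Qed.

(** Giving up 1 turns the disjunction in [robust] into a single inequality, which can be added over
    two halves. In the critical case [I] exceeds its boundary by at least 2, and [arcs_lower]
    supplies [d] arcs per excess vertex. *)
Lemma robust_weak d A I : symmetric e -> regular_on d A -> robust d 1 A ->
    1 < d -> I \subset A -> 0 < #|I| ->
  d.*2 + #|I|.*2 <= arcs I + #|bdry A I|.+2.*2.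
Proof.
move=> symE regA robA d1 sIA I0.
have [arcI|] := robA I sIA I0; last by lia.
have [lt|] := ltnP #|bdry A I|.+1 #|I|; last by lia.
have := arcs_lower symE regA sIA; set a := #|I| in lt *.
have [k ->] : exists k, a = #|bdry A I| + k.+2 by exists (a - #|bdry A I|.+2); lia.
by rewrite mulnDr; nia.
Qed.

(** The closed neighbourhood of [x] has [d + 1] vertices, all in [I] or its boundary. *)
Lemma degree_bound d A I x : irreflexive e -> regular_on d A -> I \subset A ->
  x \in I -> d < #|I| + #|bdry A I|.
Proof.
move=> irrE regA sIA xI; rewrite -(regA x (subsetP sIA _ xI)).
rewrite (cardsD1 x I) xI add1n addSn ltnS -cardsUI.
apply: leq_trans (leq_addr _ _); apply/subset_leq_card/subsetP=> y.
rewrite inE => /andP[yA exy]; rewrite in_setU in_setD1.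
have [yI|yI] := boolP (y \in I).
  by rewrite andbT; case: eqVneq => // yx; rewrite yx irrE in exy.
by rewrite andbF /=; apply/bdryP; split=> //; exists x.
Qed.

End Robust.

(** * Transport of regularity and cost bounds along induced embeddings *)

Section Transfer.
Variables (T' T : finType) (e' : rel T') (e : rel T) (j : T' -> T).
Hypotheses (injj : injective j) (jE : forall x y, e' x y = e (j x) (j y)).

Lemma nbrs_imset (I : {set T'}) x : #|nbrs e (j @: I) (j x)| = #|nbrs e' I x|.
Proof.
rewrite -(card_imset _ injj); congr #|pred_of_set _|; apply/setP=> y.
rewrite inE; apply/andP/imsetP.
  by case=> /imsetP[z zI ->] exz; exists z; rewrite // inE zI jE.
by case=> z; rewrite inE => /andP[zI exz] ->; rewrite mem_imset // zI -jE.
Qed.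

Lemma arcs_imset (I : {set T'}) : arcs e (j @: I) = arcs e' I.
Proof.
rewrite /arcs big_imset => [|x y _ _ /injj //].
by apply: eq_bigr => x _; rewrite nbrs_imset.
Qed.

Lemma bdry_imset (A I : {set T'}) :
  bdry e (j @: A) (j @: I) = j @: bdry e' A I.
Proof.
apply/setP=> y; apply/bdryP/imsetP.
  case=> /imsetP[z zA ->]; rewrite mem_imset // => zI [_ /imsetP[x xI ->]] exz.
  by exists z => //; apply/bdryP; split=> //; exists x; rewrite // jE.
case=> z /bdryP[zA zI [x xI exz]] ->; rewrite !mem_imset //; split=> //.
by exists (j x); rewrite ?mem_imset // -jE.
Qed.

Lemma regular_imset d : regular_on e' d setT -> regular_on e d (j @: setT).
Proof. by move=> reg _ /imsetP[x _ ->]; rewrite nbrs_imset reg. Qed.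

Lemma robust_imset d k : robust e' d k setT -> robust e d k (j @: setT).
Proof.
move=> rob I sI.
have {sI} -> : I = j @: (j @^-1: I).
  apply/setP=> y; apply/idP/imsetP => [yI|[x]]; last by rewrite inE => xI ->.
  have /imsetP[x _ yE] := subsetP sI y yI.
  by exists x; rewrite // inE -yE.
by rewrite bdry_imset !card_imset // arcs_imset; apply: rob; apply: subsetT.
Qed.

End Transfer.

Lemma imset_val (T : finType) (A : {set T}) :
  (val : {x | x \in A} -> T) @: setT = A.
Proof.
apply/setP=> x; apply/imsetP/idP => [[y _ ->]|xA]; first exact: (valP y).
by exists (exist _ x xA).
Qed.

Lemma regular_subrel (T : finType) (e : rel T) (A : {set T}) d :
  regular_on (Defs.subrel A e) d setT -> regular_on e d A.
Proof.
have sE x y : Defs.subrel A e x y = e (val x) (val y) by [].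
by move/(regular_imset val_inj sE); rewrite imset_val.
Qed.

Lemma robust_subrel (T : finType) (e : rel T) (A : {set T}) d k :
  robust (Defs.subrel A e) d k setT -> robust e d k A.
Proof.
have sE x y : Defs.subrel A e x y = e (val x) (val y) by [].
by move/(robust_imset val_inj sE); rewrite imset_val.
Qed.

(* [p] and [q] are two perfect matchings between [A] and its complement, given
   as involutions of the whole vertex set so that the sides are symmetric. *)
Definition two_matchings (T : finType) (e : rel T) (A : {set T}) (p q : T -> T) :=
  [/\ involutive p, involutive q, forall x, p x != q x,
      (forall x, (p x \in A) = (x \notin A)) /\
      (forall x, (q x \in A) = (x \notin A)) &
      forall x y, (x \in A) != (y \in A) -> e x y = (p x == y) || (q x == y)].

Lemma two_matchings_setC (T : finType) (e : rel T) (A : {set T}) (p q : T -> T) :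
  two_matchings e A p q -> two_matchings e (~: A) p q.
Proof.
case=> invp invq pq [pA qA] pqE; split=> // [|x y].
  by split=> x; rewrite !inE (pA, qA).
by rewrite !inE => h; apply: pqE; move: h; case: (x \in A); case: (y \in A).
Qed.

(** * Cost bounds for two halves joined by two matchings *)

Section Double.
Variables (T : finType) (e : rel T) (A : {set T}) (p q : T -> T).
Hypotheses (symE : symmetric e) (irrE : irreflexive e) (matchE : two_matchings e A p q).

Lemma regular_double d :
  regular_on e d A -> regular_on e d (~: A) -> regular_on e d.+2 setT.
Proof.
case: matchE => invp invq pq [pA qA] pqE regA regA' x _.
have side (B : {set T}) : x \in B -> regular_on e d B ->
    (forall y, (y \in B) = (x \in A) (+) ~~ (y \in A)) -> #|nbrs e setT x| = d.+2.
  move=> xB regB BE; rewrite -(regB x xB) -addn2.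
  rewrite -(cardsID B (nbrs e setT x)); congr (_ + _).
    by apply: eq_card => y; rewrite !inE andbC.
  rewrite -[RHS](_ : #|[set p x; q x]| = 2); last by rewrite cards2 pq.
  apply: eq_card => y; rewrite !inE BE.
  have [xy|xy] := boolP ((x \in A) != (y \in A)).
    rewrite pqE // ![y == _]eq_sym.
    by move: xy; case: (x \in A); case: (y \in A).
  rewrite (_ : _ (+) _ = true); last by move: xy; case: (x \in A); case: (y \in A).
  symmetry; apply: contraNF xy => /orP[]/eqP->; rewrite ?pA ?qA.
    by case: (x \in A).
  by case: (x \in A).
have [xA|xA] := boolP (x \in A).
  by apply: (side A) => // y; rewrite xA addTb negbK.
by apply: (side (~: A)) => [||y]; rewrite ?inE ?(negPf xA).
Qed.

Lemma robust_mixed d (I : {set T}) : regular_on e d A -> regular_on e d (~: A) ->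
    robust e d 1 A -> robust e d 1 (~: A) -> 5 < d ->
    I :&: A != set0 -> I :\: A != set0 ->
  d.+3.*2 + #|I|.*2 <= arcs e I + #|bdry e setT I|.+1.*2.
Proof.
move=> regA regA' robA robA' d5; rewrite -!card_gt0 => I0 I0'.
have /(_ I0) h1 := robust_weak symE regA robA (ltn_trans (isT : 1 < 5) d5) (subsetIr I A).
have sD : I :\: A \subset ~: A by rewrite setDE subsetIr.
have /(_ I0') h2 := robust_weak symE regA' robA' (ltn_trans (isT : 1 < 5) d5) sD.
have hI := cardsID A I.
have hb : #|bdry e A (I :&: A)| + #|bdry e (~: A) (I :\: A)| <= #|bdry e setT I|.
  rewrite -(cardsID A (bdry e setT I)); apply: leq_add; apply/subset_leq_card/subsetP=> y.
    case/bdryP=> yA; rewrite in_setI yA andbT => yI [x /setIP[xI _] exy].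
    by rewrite in_setI yA andbT; apply/bdryP; split=> //; exists x.
  case/bdryP; rewrite in_setC in_setD => yA; rewrite yA => yI [x /setDP[xI _] exy].
  by rewrite in_setD yA; apply/bdryP; split=> //; exists x.
have ha : arcs e (I :&: A) + arcs e (I :\: A) <= arcs e I.
  rewrite [X in _ <= X](big_setID A) /=; apply: leq_add; apply: leq_sum => x _;
    apply/subset_leq_card/subsetP=> y; rewrite !inE.
    by case/andP=> /andP[-> _] ->.
  by case/andP=> /andP[_ ->] ->.
(* The weak bounds sum to [4 * d + 2 * #|I| <= arcs e I + 2 * #|bdry e setT I| + 8]; reaching the
   goal from there takes [d >= 6]. *)
by move: h1 h2 hI hb ha; lia.
Qed.

(** The matchings add the outer neighbours [N], at least [#|I|] of them and two for a singleton. A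
    further unit is gained unless [I] is a pair with only two outer neighbours, which then form a
    4-cycle with it. *)
Lemma robust_one_side d (I : {set T}) : regular_on e d A -> robust e d 1 A -> 5 < d ->
    I \subset A -> 0 < #|I| ->
  d.+2.*2 + #|I|.*2 <= arcs e I + #|bdry e setT I|.+1.*2 /\
  (1 < #|I| ->
   d.+3.*2 + #|I|.*2 <= arcs e I + #|bdry e setT I|.+1.*2 \/
   exists x y, [/\ x != y, (x \in A) = (y \in A), p x = q y & q x = p y]).
Proof.
case: matchE => invp invq pq [pA qA] pqE regA robA d5 sIA I0.
have [x xI] := card_gt0P I0.
have hdeg := degree_bound irrE regA sIA xI.
have hw := robust_weak symE regA robA (ltn_trans (isT : 1 < 5) d5) sIA I0.
have hr := robA I sIA I0.
have injp := inv_inj invp; have injq := inv_inj invq.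
pose N := p @: I :|: q @: I.
have hN : #|bdry e A I| + #|N| <= #|bdry e setT I|.
  rewrite -(cardsID A (bdry e setT I)); apply: leq_add; apply/subset_leq_card/subsetP=> y.
    by case/bdryP=> yA yI ex; rewrite in_setI yA andbT; apply/bdryP; split.
  have out z : z \in I -> z \in A by apply: (subsetP sIA).
  case/setUP=> /imsetP[z zI ->]; have zA := out _ zI; apply/setDP;
    rewrite ?pA ?qA zA; split=> //; apply/bdryP; split; rewrite ?inE //.
  - by apply: contraTN zA => /out; rewrite pA.
  - by exists z; rewrite // pqE ?eqxx // pA zA.
  - by apply: contraTN zA => /out; rewrite qA.
  - by exists z; rewrite // pqE ?eqxx ?orbT // qA zA.
have hpN : #|I| <= #|N|.
  by rewrite -(card_imset _ injp) subset_leq_card // subsetUl.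
have [I1|I1] := eqVneq #|I| 1.
  have hN2 : 2 <= #|N|.
    rewrite (_ : 2 = #|[set p x; q x]|); last by rewrite cards2 pq.
    rewrite subset_leq_card //; apply/subsetP=> y /set2P[]->;
      by rewrite inE imset_f ?orbT.
  by split; [move: hdeg hr hN; rewrite I1; lia | rewrite I1].
split; first by move: hdeg hr hN hw I1; lia.
move=> Igt1; have [I2|I2] := eqVneq #|I| 2; last first.
  (* For [#|I| >= 4] the weak bound suffices; for [#|I| = 3] the full disjunction is used, with the
     degree bound when the arcs alone reach [d.*2]. *)
  by left; move: hdeg hr hN hw I1 I2; lia.
have [hN3|hN3] := ltnP 2 #|N|; first by left; move: hdeg hr hN hw I2; lia.
right; have [y yI] : exists2 y, y \in I & y != x.
  have : 0 < #|I :\ x| by move: I2; rewrite (cardsD1 x) xI; lia.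
  by case/card_gt0P=> y /setD1P[yx yI]; exists y.
move=> yx; exists x, y.
(* With only two outer neighbours, [p] and [q] have the same image of the pair; as they differ at
   each vertex, they are swapped. *)
have NE : p @: I = N.
  by apply/eqP; rewrite eqEcard subsetUl card_imset // I2.
have IE : I = [set x; y].
  apply/esym/eqP; rewrite eqEcard I2 cards2 eq_sym yx andbT.
  by apply/subsetP=> z /set2P[]->.
have qN z : z \in I -> q z = p x \/ q z = p y.
  move=> zI; have : q z \in p @: I by rewrite NE inE imset_f ?orbT.
  by rewrite IE imsetU !imset_set1 => /set2P.
split; rewrite 1?eq_sym //; first by rewrite !(subsetP sIA).
  by case: (qN y yI) => // /eqP; rewrite eq_sym (negPf (pq y)).
by case: (qN x xI) => // /eqP; rewrite eq_sym (negPf (pq x)).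
Qed.

End Double.

(** * Exhaustive verification for AQ_4 *)

Fixpoint bits n : seq bitseq :=
  if n is n'.+1 then map (cons false) (bits n') ++ map (cons true) (bits n')
  else [:: [::]].

Definition far (s : seq bitseq) (y : bitseq) :=
  (y \notin s) && ~~ has (aq^~ y) s.

Fixpoint edges (s : seq bitseq) : nat :=
  if s is v :: s' then count (aq v) s' + edges s' else 0.

(* [search rest s out k] runs through all extensions of [s] by elements of
   [rest], where [k] is the number of edges inside [s] and [out] lists the
   vertices outside the closed neighbourhood of [s]. A branch stops as soon as
   [k] reaches 8, since [k] only grows. At a leaf the boundary of [s] has
   [16 - size s - size out] vertices, whence the bound [k + 9]. *)
Fixpoint search (rest s out : seq bitseq) (k : nat) : bool :=
  if 8 <= k then true else
  if rest is v :: rest' then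
    search rest' s out k &&
    search rest' (v :: s) [seq y <- out | (y != v) && ~~ aq v y]
      (count (aq v) s + k)
  else (size s <= 1) || (size s + size s + size out <= k + 9).


Lemma mem_bits n x : (x \in bits n) = (size x == n).
Proof.
elim: n x => [|n IHn] [|b x] //=.
  by rewrite mem_cat; apply/norP; split; apply/mapP; case.
have consE c : (b :: x \in map (cons c) (bits n)) = (b == c) && (size x == n).
  apply/mapP/andP => [[y yn [-> ->]]|[/eqP-> xn]]; first by rewrite eqxx -IHn.
  by exists x; rewrite // IHn.
by rewrite mem_cat !consE eqSS; case: (b) => /=; rewrite ?orbF.
Qed.

Lemma uniq_bits n : uniq (bits n).
Proof.
elim: n => //= n IHn; have inj c : injective (cons c : bitseq -> bitseq) by move=> x y [].
rewrite cat_uniq !map_inj_uniq // IHn andbT /=.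
by apply/hasPn=> _ /mapP[x _ ->]; apply/mapP; case.
Qed.

Lemma card_bits n (P : pred bitseq) : #|[set x : n.-tuple bool | P x]| = count P (bits n).
Proof.
rewrite cardsE cardE /enum_mem size_filter -(count_map (@tval n bool) P).
apply/permP/uniq_perm; rewrite ?uniq_bits ?(map_inj_uniq val_inj) -?enumT ?enum_uniq //.
move=> x; rewrite mem_bits; apply/mapP/eqP => [[t _ ->]|<-]; first exact: size_tuple.
by exists (in_tuple x); rewrite ?mem_enum.
Qed.

Lemma all_differ_sym : symmetric all_differ.
Proof. by elim=> [|a u IHu] [|b v] //=; rewrite eq_sym IHu. Qed.

Lemma aq_sym : symmetric aq.
Proof.
elim=> [|a u IHu] [|b v] //=.
by rewrite eq_sym IHu [u == v]eq_sym all_differ_sym.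
Qed.

Lemma aq_irr : irreflexive aq.
Proof. by elim=> [|a u IHu] //=; rewrite eqxx. Qed.

Lemma edges_catrev t s : edges s <= edges (catrev t s).
Proof.
elim: t s => //= v t IHt s.
exact: leq_trans (leq_addl _ _) (IHt (v :: s)).
Qed.

Lemma arcs_edges s : \sum_(x <- s) count (aq x) s = (edges s).*2.
Proof.
elim: s => [|v s IHs]; first by rewrite big_nil.
rewrite big_cons /= aq_irr add0n big_split /= IHs.
rewrite (_ : \sum_(i <- s) _ = count (aq v) s); first by rewrite doubleD -addnn; lia.
by rewrite -sum1_count [RHS]big_mkcond; apply: eq_bigr => x _; rewrite aq_sym; case: aq.
Qed.

(** [P] selects one branch of the search. The invariant is that the last two arguments of [search]
    are the vertices far from [s] and the number of edges inside [s]. *)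
Lemma searchP V rest s (P : pred bitseq) (s' := catrev (filter P rest) s) :
    search rest s (filter (far s) V) (edges s) ->
  [|| 8 <= edges s', size s' <= 1 |
    size s' + size s' + count (far s') V <= edges s' + 9].
Proof.
rewrite {}/s'; elim: rest s => [|v rest IH] s /=.
  by case: ifP => //= _; rewrite size_filter.
case: ifP => [k8 _|_ /andP[h0 h1]].
  by rewrite (leq_trans k8 (edges_catrev _ _)).
case: (P v) => /=; apply: IH => //; rewrite /= in h1 *.
congr (search _ _ _ _) : h1; rewrite -filter_predI; apply: eq_filter => y.
by rewrite /far /= inE !negb_or; case: eqP; case: aq; case: (y \in s).
Qed.

Lemma search_AQ4 : search (rev (bits 4)) [::] (bits 4) 0.
Proof. by vm_compute. Qed.

Lemma AQ4_regular : regular_on (@AQrel 4) 7 setT.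
Proof.
have deg : all (fun x => count (aq x) (bits 4) == 7) (bits 4) by vm_compute.
move=> x _; rewrite /nbrs (_ : [set y in setT | _] = [set y : 4.-tuple bool | aq x y]).
  rewrite card_bits; apply/eqP/(allP deg).
  by rewrite mem_bits size_tuple.
by apply/setP=> y; rewrite !inE.
Qed.

Lemma AQ4_robust : robust (@AQrel 4) 8 2 setT.
Proof.
move=> I _ I2.
pose P := [pred s : bitseq | [exists x in I, val x == s]].
have PE x : P (val x) = (x \in I).
  apply/existsP/idP => [[y /andP[yI /eqP/val_inj <-]] //|xI].
  by exists x; rewrite xI eqxx.
pose s := filter P (bits 4).
(* The search conses the vertices it picks, so running it on the reversed list yields [s] in its own
   order. *)
have sE : s = catrev (filter P (rev (bits 4))) [::] by rewrite -/(rev _) filter_rev revK.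
have cardE (J : {set 4.-tuple bool}) (Q : pred bitseq) :
    (forall x : 4.-tuple bool, (x \in J) = Q x) -> #|J| = count Q (bits 4).
  by move=> JQ; rewrite -card_bits; apply: eq_card => x; rewrite inE JQ.
have mem_s (x : 4.-tuple bool) : (tval x \in s) = (x \in I).
  by rewrite mem_filter mem_bits size_tuple eqxx andbT -PE.
have sizeI : #|I| = size s by rewrite size_filter; apply: cardE => x; rewrite -PE.
have arcsI : arcs (@AQrel 4) I = (edges s).*2.
  rewrite -arcs_edges /arcs.
  rewrite (eq_bigr (fun x : 4.-tuple bool => count (aq x) s)) => [|x xI].
    rewrite -big_enum -(big_map (@tval 4 bool) predT (fun x => count (aq x) s)).
    apply: perm_big; apply: uniq_perm.
    - by rewrite (map_inj_uniq val_inj) enum_uniq.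
    - by rewrite filter_uniq // uniq_bits.
    move=> x; apply/mapP/idP => [[y yI ->]|].
      by rewrite mem_s -mem_enum.
    rewrite mem_filter => /andP[/existsP[y /andP[yI /eqP<-]] _].
    by exists y; rewrite ?mem_enum.
  rewrite count_filter; apply: cardE => y; rewrite !inE -PE andbC.
  by [].
(* [I], its boundary and the far vertices partition the 16 vertices. *)
have bdryI : size s + #|bdry (@AQrel 4) setT I| + count (far s) (bits 4) = 16.
  rewrite -sizeI -(@cardE [set x : 4.-tuple bool | far s x]) => [|x]; last by rewrite inE.
  rewrite -cardsUI (_ : _ :&: _ = set0) ?cards0 ?addn0; last first.
    by apply/setP=> x; rewrite !inE; case: (x \in I).
  rewrite (_ : [set x | _] = ~: (I :|: bdry (@AQrel 4) setT I)).
    by rewrite cardsC card_tuple card_bool.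
  apply/setP=> x; rewrite !inE /far mem_s; case: (x \in I) => //=.
  congr (~~ _); apply/hasP/existsP => [[y]|[y /andP[yI exy]]].
    rewrite mem_filter => /andP[/existsP[z /andP[zI /eqP<-]] _] ezx.
    by exists z; rewrite zI.
  by exists (val y); rewrite ?mem_s.
have := @searchP (bits 4) (rev (bits 4)) [::] P.
rewrite (_ : filter (far [::]) _ = bits 4); last exact: filter_predT.
move=> /(_ search_AQ4); rewrite -sE arcsI sizeI.
by move: sizeI I2 bdryI; lia.
Qed.

Lemma robust_singleton (T : finType) (e : rel T) d (A : {set T}) :
  irreflexive e -> regular_on e d A -> robust e d.+1 2 A -> robust e d 1 A.
Proof.
move=> irrE regA robA I sIA I0; have [I2|I1] := ltnP 1 #|I|.
  by have [] := robA I sIA I2; [left|right]; lia.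
have [x xI] := card_gt0P I0.
by right; have := degree_bound irrE regA sIA xI; lia.
Qed.

Lemma isoAQ4_props (T : finType) (e : rel T) : isoAQ 4 e ->
  [/\ symmetric e, irreflexive e, regular_on e 7 setT,
      robust e 8 2 setT & 0 < #|T|].
Proof.
case=> f [[g fK gK] eE].
have gE x y : AQrel x y = e (g x) (g y) by rewrite eE !gK.
have imT : g @: setT = setT.
  by apply/setP=> x; rewrite inE; apply/imsetP; exists (f x); rewrite ?fK.
have injg : injective g by apply: can_inj gK.
split.
- by move=> x y; rewrite !eE /AQrel aq_sym.
- by move=> x; rewrite eE /AQrel aq_irr.
- by rewrite -imT; apply: (regular_imset injg gE AQ4_regular).
- by rewrite -imT; apply: (robust_imset injg gE AQ4_robust).
by apply/card_gt0P; exists (g [tuple of nseq 4 false]).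
Qed.

(** * Induction over the generalized augmented cubes *)

Lemma matching_involution (T : finType) (A : {set T})
    (g : {x : T | x \in A} -> {x : T | x \in ~: A}) : bijective g ->
  exists p : T -> T, [/\ involutive p,
    forall x, (p x \in A) = (x \notin A) & forall u, p (val u) = val (g u)].
Proof.
case=> g' gK g'K.
have outE (v : {x : T | x \in ~: A}) : val v \in A = false.
  by have := valP v; rewrite inE => /negPf.
(* [g] on [A] and its inverse on the complement; by [xP] the final default is never reached. *)
pose p x := if insub x is Some u then val (g u)
  else if insub x is Some v then val (g' v) else x.
have pl u : p (val u) = val (g u) by rewrite /p valK.
have pr v : p (val v) = val (g' v) by rewrite /p insubF ?outE // valK.
have xP x : (exists u : {x | x \in A}, x = val u) \/
    (exists v : {x | x \in ~: A}, x = val v).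
  have [xA|xA] := boolP (x \in A); [left|right; rewrite -in_setC in xA].
    by exists (exist _ x xA).
  by exists (exist _ x xA).
exists p; split=> // x; case: (xP x) => -[u ->].
- by rewrite pl pr gK.
- by rewrite pr pl g'K.
- by rewrite pl outE (valP u).
by rewrite pr (valP (g' u)) outE.
Qed.

Lemma two_matchings_exist (T : finType) (e : rel T) (A : {set T})
    (g1 g2 : {x : T | x \in A} -> {x : T | x \in ~: A}) :
    bijective g1 -> bijective g2 -> (forall x, g1 x != g2 x) -> symmetric e ->
    (forall x y, e (val x) (val y) = (g1 x == y) || (g2 x == y)) ->
  exists p q, two_matchings e A p q.
Proof.
move=> /matching_involution[p [invp pA pE]] /matching_involution[q [invq qA qE]].
move=> g12 symE eE; exists p, q.
have pqE x y : x \in A -> y \notin A -> e x y = (p x == y) || (q x == y).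
  move=> xA; rewrite -in_setC => yA.
  have := eE (exist _ x xA) (exist _ y yA); rewrite /= => ->.
  by rewrite -!val_eqE -pE -qE.
have pqA x : x \in A -> p x != q x.
  move=> xA; have := g12 (exist _ x xA).
  by rewrite -val_eqE -pE -qE.
split=> // [x|x y].
  have [/pqA //|xA] := boolP (x \in A).
  have /pqA : p x \in A by rewrite pA.
  rewrite invp; apply: contraNneq => E.
  by rewrite E invq.
have [xA|xA] := boolP (x \in A); have [yA|yA] := boolP (y \in A);
  rewrite ?eqxx //= => _.
  exact: pqE.
by rewrite symE pqE // (inv_eq invp) (inv_eq invq) ![y == _]eq_sym.
Qed.

Section Doubling.
Variables (T : finType) (e : rel T) (A : {set T}) (d : nat).
Hypotheses (symE : symmetric e) (irrE : irreflexive e) (d5 : 5 < d).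
Hypotheses (regA : regular_on e d A) (regA' : regular_on e d (~: A)).
Hypotheses (robA : robust e d 1 A) (robA' : robust e d 1 (~: A)).
Variables (p q : T -> T).
Hypothesis matchE : two_matchings e A p q.

Lemma robust_double : robust e d.+2 1 setT.
Proof.
move=> I _ I0; right; have [IA|IA] := eqVneq (I :\: A) set0.
  have sIA : I \subset A by rewrite -setD_eq0 IA.
  by have [] := robust_one_side symE irrE matchE regA robA d5 sIA I0.
have [IA'|IA'] := eqVneq (I :&: A) set0; last first.
  by have := robust_mixed symE regA regA' robA robA' d5 IA' IA; lia.
have sIA : I \subset ~: A by rewrite subsets_disjoint setCK -setI_eq0 IA'.
by have [] := robust_one_side symE irrE (two_matchings_setC matchE) regA' robA' d5 sIA I0.
Qed.

Lemma robust_double_super :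
    (forall x y, x != y -> (x \in A) = (y \in A) -> p x = q y -> q x <> p y) ->
  robust e d.+3 2 setT.
Proof.
move=> no4 I _ I2; have I0 := ltnW I2; right.
have [IA|IA] := eqVneq (I :\: A) set0.
  have sIA : I \subset A by rewrite -setD_eq0 IA.
  have [_ /(_ I2)[//|]] := robust_one_side symE irrE matchE regA robA d5 sIA I0.
  by case=> x [y [xy AE pq qp]]; case: (no4 x y).
have [IA'|IA'] := eqVneq (I :&: A) set0; last first.
  exact: (robust_mixed symE regA regA' robA robA' d5 IA' IA).
have sIA : I \subset ~: A by rewrite subsets_disjoint setCK -setI_eq0 IA'.
have [_ /(_ I2)[//|]] :=
  robust_one_side symE irrE (two_matchings_setC matchE) regA' robA' d5 sIA I0.
case=> x [y [xy AE pq qp]]; case: (no4 x y) => //.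
by move: AE; rewrite !inE => /negb_inj.
Qed.

End Doubling.

(** Otherwise [x], [p x = q y], [y], [q x = p y] would be a 4-cycle of matching edges. *)
Lemma no_4_cycle (T : finType) (e : rel T) (A : {set T}) (p q : T -> T) x y :
    symmetric e -> two_matchings e A p q ->
    ~ has_cycle 4 (fun x y => e x y && ((x \in A) != (y \in A))) ->
  x != y -> (x \in A) = (y \in A) -> p x = q y -> q x <> p y.
Proof.
move=> symE [invp invq pq [pA qA] eE] no4 xy AE pqE qpE; apply: no4.
exists [:: x; p x; y; q x]; split=> //; split.
  have side a b : (b \in A) = (a \notin A) -> a != b.
    by move=> h; apply: contraTneq isT => E; move: h; rewrite E; case: (b \in A).
  rewrite /= !inE !negb_or xy pq !side ?pA ?qA ?negbK -?AE //.
have h a : e a (p a) && ((a \in A) != (p a \in A)).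
  by rewrite eE pA ?eqxx //; case: (a \in A).
have h' a : e a (q a) && ((a \in A) != (q a \in A)).
  by rewrite eE qA ?eqxx ?orbT //; case: (a \in A).
have hV a : e (q a) a && ((q a \in A) != (a \in A)).
  by rewrite symE eq_sym h'.
by rewrite /=; apply/and5P; split=> //; rewrite ?pqE // qpE.
Qed.

Lemma irreflexive_halves (T : finType) (e : rel T) (A : {set T}) :
  irreflexive (Defs.subrel A e) -> irreflexive (Defs.subrel (~: A) e) -> irreflexive e.
Proof.
move=> irr1 irr2 x; have [xA|] := boolP (x \in A).
  exact: (irr1 (exist _ x xA)).
by rewrite -in_setC => xA; apply: (irr2 (exist _ x xA)).
Qed.

(** The invariant of the induction; [4 <= n] keeps the degree of the halves above the threshold 5 of
    the doubling lemmas. *)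
Lemma GAQ_props n (T : finType) (e : rel T) : isGAQ n e ->
  [/\ symmetric e, irreflexive e,
      regular_on e (2 * n - 1) setT, robust e (2 * n - 1) 1 setT &
      4 <= n /\ 0 < #|T|].
Proof.
elim=> {n T e} [T e /isoAQ4_props[symE irrE reg rob T0]|].
  by split=> //; apply: robust_singleton.
move=> n T e A g1 g2 _ [_ irr1 reg1 rob1 [n4 T1]] _ [_ irr2 reg2 rob2 _].
move=> bij1 bij2 g12 symE eE.
have irrE := irreflexive_halves irr1 irr2.
have regA := regular_subrel reg1; have robA := robust_subrel rob1.
have regA' := regular_subrel reg2; have robA' := robust_subrel rob2.
have [p [q matchE]] := two_matchings_exist bij1 bij2 g12 symE eE.
have d5 : 5 < 2 * n - 1 by lia.
have -> : 2 * n.+1 - 1 = (2 * n - 1).+2 by lia.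
split=> //.
- exact: (regular_double matchE regA regA').
- exact: (robust_double symE irrE d5 regA regA' robA robA' matchE).
split; first exact: leqW.
by have [x _] := card_gt0P T1; apply/card_gt0P; exists (val x).
Qed.

(** The halves enter only through the bounds valid for all generalized cubes; the extra unit comes
    from the last doubling, or from the search for AQ_4. *)
Lemma RGAQ_props n (T : finType) (e : rel T) : isRGAQ n e ->
  isGAQ n e /\ robust e (2 * n) 2 setT.
Proof.
case=> [[-> iso]|].
  by split; [apply: GAQ_base | have [] := isoAQ4_props iso].
case=> n' [-> [n4 [A [g1 [g2 [[G1 G2 bij1 bij2 g12] [symE [eE [no4 _]]]]]]]]].
split; first exact: GAQ_step G1 G2 bij1 bij2 g12 symE eE.
have [_ irr1 reg1 rob1 _] := GAQ_props G1.
have [_ irr2 reg2 rob2 _] := GAQ_props G2.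
have irrE := irreflexive_halves irr1 irr2.
have regA := regular_subrel reg1; have robA := robust_subrel rob1.
have regA' := regular_subrel reg2; have robA' := robust_subrel rob2.
have [p [q matchE]] := two_matchings_exist bij1 bij2 g12 symE eE.
have d5 : 5 < 2 * n' - 1 by lia.
have -> : 2 * n'.+1 = (2 * n' - 1).+3 by lia.
apply: (robust_double_super symE irrE d5 regA regA' robA robA' matchE).
by move=> x y; apply: no_4_cycle.
Qed.

(** * From a deleted set to the cost of an independent set *)

Section Cost.
Variables (T : finType) (e : rel T) (FV : {set T}) (FE : {set {set T}}).
Hypothesis symE : symmetric e.

Lemma del_rel_sym : symmetric (del_rel e FV FE).
Proof. by move=> x y; rewrite /del_rel symE setUC; congr (_ && _); rewrite andbCA. Qed.

(** Double counting of incidences: distinct arcs at [x] give distinct deleted edges through [x], and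
    each edge has at most two ends. *)
Lemma arcs_le_edges (I : {set T}) : valid_F e FE ->
    {in I &, forall x y, e x y -> [set x; y] \in FE} ->
  arcs e I <= #|[set S in FE | S \subset I]|.*2.
Proof.
move=> validF inF; pose FI := [set S in FE | S \subset I].
have h1 x : x \in I -> #|nbrs e I x| <= \sum_(S in FI) (x \in S : nat).
  move=> xI; rewrite -(card_in_imset (f := fun y => [set x; y])) => [|y z _ _ E].
    rewrite -big_mkcondr /= sum1_card; apply/subset_leq_card/subsetP=> _ /imsetP[y + ->].
    rewrite inE => /andP[yI exy]; rewrite unfold_in /= set21 inE inF //= andbT.
    by apply/subsetP=> z /set2P[]->.
  have : y \in [set x; z] by rewrite -E set22.
  case/set2P=> // yx; have : z \in [set x; y] by rewrite E set22.
  by rewrite yx => /set2P[]->.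
apply: (@leq_trans (\sum_(x in I) \sum_(S in FI) (x \in S))); first exact: leq_sum.
rewrite exchange_big /=.
rewrite -muln2 -sum_nat_const; apply: leq_sum => S; rewrite inE => /andP[/validF].
case=> x [y [_ SE]] _; rewrite -big_mkcondr /= sum1_card.
apply: (@leq_trans #|S|); last by rewrite SE cards2; case: eqP.
by apply/subset_leq_card/subsetP=> z; rewrite unfold_in => /andP[].
Qed.

Lemma crossing_le_edges (I : {set T}) :
  #|[set y | (y \notin I) && [exists x in I, [set x; y] \in FE]]|
    <= #|FE :\: [set S in FE | S \subset I]|.
Proof.
set B := [set y | _].
(* One deleted edge is chosen for each [y]; it determines [y], its only end outside [I]. The default
   is not taken on [B]. *)
pose f y := [set odflt y [pick x in I | [set x; y] \in FE]; y].
have fP y : y \in B ->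
    exists x, [/\ f y = [set x; y], x \in I, y \notin I & [set x; y] \in FE].
  rewrite inE /f => /andP[yI /existsP[x xP]].
  case: pickP => [z /andP[zI zF]|/(_ x)]; last by rewrite xP.
  by exists z.
rewrite -(card_in_imset (f := f) (D := B)).
  apply/subset_leq_card/subsetP=> _ /imsetP[y /fP[x [-> xI yI xyF]] ->].
  rewrite in_setD inE xyF andbT /=; apply: contra yI => /subsetP; apply.
  by rewrite set22.
move=> y z /fP[x [-> xI yI _]] /fP[x' [-> xI' zI _]] E.
have : y \in [set x'; z] by rewrite -E set22.
by case/set2P=> // yx; rewrite yx xI' in yI.
Qed.

(** A boundary vertex of the independent violator [I] is deleted, survives as a neighbour of [I], or
    has a deleted edge to [I]. The edges of the last kind are disjoint from those inside [I], so
    both are charged to [FE]. A singleton violator has no surviving neighbour and is isolated. *)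
Lemma FSMP_cost : FSMP_set e FV FE ->
  exists I : {set T}, [/\ 0 < #|I|, arcs e I <= #|FE|.*2,
    arcs e I + #|bdry e setT I|.+1.*2 <= (#|FV| + #|FE|).*2 + #|I|.*2 &
    #|I| = 1 -> exists x, x \notin FV /\ forall y, ~~ del_rel e FV FE x y].
Proof.
case=> validF nofpm.
have hW x y : del_rel e FV FE x y -> y \in ~: FV.
  by case/and4P=> _ _; rewrite inE.
have [I [sIW indI ltI]] := no_fpm_independent del_rel_sym hW nofpm.
have out x : x \in I -> x \notin FV by move/(subsetP sIW); rewrite inE.
have inF : {in I &, forall x y, e x y -> [set x; y] \in FE}.
  move=> x y xI yI exy; apply: contraNT (indI x y xI yI) => nF.
  by rewrite /del_rel exy nF !out.
have h1 := arcs_le_edges validF inF.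
have h2 := crossing_le_edges I.
set FI := [set S in FE | _] in h1 h2; set B := [set y | _] in h2.
have h3 : #|FI| + #|FE :\: FI| = #|FE|.
  rewrite -(cardsID FI FE) (setIidPr _) //.
  by apply/subsetP=> S; rewrite inE => /andP[].
have h4 : #|bdry e setT I| <= #|FV| + #|nbhd (del_rel e FV FE) (~: FV) I| + #|B|.
  apply: (@leq_trans #|FV :|: nbhd (del_rel e FV FE) (~: FV) I :|: B|); last first.
    by rewrite !cardsU; lia.
  apply/subset_leq_card/subsetP=> y /bdryP[_ yI [x xI exy]]; rewrite 2!in_setU -orbA.
  have [//|yF] := boolP (y \in FV); have [xyF|xyF] := boolP ([set x; y] \in FE).
    apply/orP; right; apply/orP; right.
    by rewrite inE yI; apply/existsP; exists x; rewrite xI.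
  apply/orP; right; apply/orP; left; apply/nbhdP; rewrite inE yF; split=> //.
  by exists x; rewrite // /del_rel exy yF xyF out.
exists I; split; [by lia | by lia | by move: h1 h2 h3 h4 ltI; lia |].
move/eqP/cards1P=> [x IE]; exists x; split; first by rewrite out // IE set11.
move=> y; apply/negP => hxy; move: ltI; rewrite IE cards1 ltnS leqn0 cards_eq0.
by move/eqP/setP/(_ y); rewrite in_set0 => /negP[]; apply/nbhdP; split;
  [apply: hW hxy | exists x; rewrite ?set11].
Qed.

End Cost.

(** * Fractional strong matching preclusion numbers *)

Lemma robust_fsmp (T : finType) (e : rel T) d :
    symmetric e -> irreflexive e -> regular_on e d setT -> robust e d 1 setT ->
    0 < #|T| ->
  fsmp_is e d.
Proof.
move=> symE irrE reg rob /card_gt0P[x _]; split.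
  (* Deleting all neighbours of [x] isolates it, and the empty sum at [x] is not 1. *)
  exists (nbrs e setT x), set0; rewrite cards0 addn0 reg //; split=> //.
  split=> [S|[f [_ [_ /(_ x)]]]]; first by rewrite inE.
  rewrite !inE irrE => /(_ isT); rewrite big_pred0 => [|y].
    by move/esym/R1_neq_R0.
  by rewrite /del_rel !inE; case: (e x y); rewrite ?andbF.
move=> FV FE /(FSMP_cost symE)[I [I0 hI1 hI2 _]].
by have [] := rob I (subsetT _) I0; lia.
Qed.

Lemma regular_min_degree (T : finType) (e : rel T) d :
  regular_on e d setT -> 0 < #|T| -> min_degree e = d.
Proof.
move=> reg T0; have deg x : #|[set y | e x y]| = d.
  by rewrite -(reg x (in_setT x)); apply: eq_card => y; rewrite !inE.
rewrite /min_degree (eq_bigr _ (fun x _ => deg x)) big_const.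
(* The initial value [#|T|] of the minimum is at least [d], so it does not affect the result. *)
have [x _] := card_gt0P T0; have : d <= #|T| by rewrite -(deg x) max_card.
have le_iter k N : d <= N -> d <= iter k (minn d) N.
  by move=> dN; elim: k => //= k IHk; rewrite leq_min leqnn.
by case: #|T| T0 => // m _ dT; apply/minn_idPl/le_iter.
Qed.

Theorem theorem3p10 (n : nat) (hn : 4 <= n) :
  (forall (T : finType) (e : rel T), isGAQ n e ->
     frac_strongly_max_matched e /\ fsmp_is e (2 * n - 1)) /\
  (forall (T : finType) (e : rel T), isRGAQ n e ->
     frac_strongly_super_matched e).
Proof.
have max (T : finType) (e : rel T) : isGAQ n e ->
    frac_strongly_max_matched e /\ fsmp_is e (2 * n - 1).
  case/GAQ_props=> symE irrE reg rob [_ T0].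
  have fsmp := robust_fsmp symE irrE reg rob T0.
  by split=> //; rewrite /frac_strongly_max_matched (regular_min_degree reg).
split=> // T e /RGAQ_props[G rob]; have [maxE [[FV0 [FE0 [F0 c0]]] minE]] := max T e G.
split=> // k [_ mink] FV FE F cF.
have := mink _ _ F0; have := minE _ _ F; rewrite c0 => hk1 hk2.
have [symE _ _ _ _] := GAQ_props G.
have [I [I0 hI1 hI2]] := FSMP_cost symE F; apply.
(* Two or more vertices would cost at least [2 * n], but [F] has size at most [2 * n - 1]; hence [I]
   is a singleton and its vertex is isolated. *)
have [I2|] := ltnP 1 #|I|; last by lia.
by have [] := rob I (subsetT _) I2; lia.
Qed.
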